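(* For every integer $n\ge 8$, $$\mathrm{ex}(n,K_3,\widehat P_4)=\left\lfloor \frac{n^2}{8}\right\rfloor .$$ Moreover, $\mathrm{ex}(4,K_3,\widehat P_4)=4$, $\mathrm{ex}(5,K_3,\widehat P_4)=4$, $\mathrm{ex}(6,K_3,\widehat P_4)=5$ and $\mathrm{ex}(7,K_3,\widehat P_4)=8$.
   Context: All graphs are finite and simple. $P_4$ denotes the path on $4$ vertices. For a graph $G$, its suspension $\widehat G$ is the graph obtained from $G$ by adding one new vertex and joining it to every vertex of $G$; thus $\widehat P_4$ is a $5$-vertex graph. For graphs $T$ and $H$, $\mathrm{ex}(n,T,H)$ denotes the maximum number of copies of $T$ in an $n$-vertex graph that contains no copy of $H$ as a (not necessarily induced) subgraph. $K_3$ is the triangle, so $\mathrm{ex}(n,K_3,\widehat P_4)$ is the maximum number of triangles in an $n$-vertex graph containing no subgraph isomorphic to $\widehat P_4$. *)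

(* Defs.v *)
From mathcomp Require Import all_boot.
Set Implicit Arguments. Unset Strict Implicit. Unset Printing Implicit Defensive.

Definition simple_graph (n : nat) (E : {set 'I_n * 'I_n}) : bool :=
  [forall x, (x, x) \notin E] &&
  [forall x, forall y, ((x, y) \in E) == ((y, x) \in E)].

Definition triangles (n : nat) (E : {set 'I_n * 'I_n}) : nat :=
  #|[set T : {set 'I_n} | (#|T| == 3) &&
      [forall x in T, forall y in T, (x != y) ==> ((x, y) \in E)]]|.

(* The suspension of P_4: path 0-1-2-3 plus vertex 4 joined to all. *)
Definition p4hat_edge (i j : 'I_5) : bool :=
  (val i != val j) &&
  [|| val i == 4, val j == 4, val i == (val j).+1 | val j == (val i).+1].

Definition contains_p4hat (n : nat) (E : {set 'I_n * 'I_n}) : bool :=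
  [exists f : {ffun 'I_5 -> 'I_n},
    injectiveb f && [forall i, forall j, p4hat_edge i j ==> ((f i, f j) \in E)]].

Definition ex_K3_P4hat (n : nat) : nat :=
  \max_(E : {set 'I_n * 'I_n} | simple_graph E && ~~ contains_p4hat E) triangles E.

(* Main.v *)
Require Import Defs.
From mathcomp Require Import all_boot zify.

(** In a graph without the suspended path every link is P4-free.  Hence a vertex
outside a K4 has at most one neighbour in it, so the [k] K4's pairwise share at
most one vertex, and a triangle outside all K4's (a "book" triangle) has a
vertex, its apex, such that the two sides through it lie in no other triangle.
Call these two sides the legs, and let [b] be the number of book triangles: the
number of triangles is at most [4 k + b], and there are [2 b] legs.  The legs
together with the K4 edges contain no triangle through a leg, and each K4 sends
at most [n - 4] edges out.

If [v] has [s v] legs and lies in [r v] K4's, let [D v = s v + 3 r v].  As in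
Mantel's theorem, the two facts above bound the sum of [s v * D v] by [2 n b]
and that of [r v * D v] by [k (n + 8)]; comparing the sum of [D v ^ 2] with the
sum of [D v] gives [n ^ 2 / 8] for [n >= 16].  For [n <= 15] the legs meeting a K4
are counted by the second bound, those between the [N] vertices in no K4 by
Mantel's theorem.  This leaves finitely many possible values of [k], [N] and the
number of intersections of K4's; three of them need the extra remark that a book
triangle meets every K4 at most once.

The extremal graph is complete bipartite plus a perfect matching in one part;
for [n <= 7], two K4's sharing a vertex. *)

Set Implicit Arguments. Unset Strict Implicit. Unset Printing Implicit Defensive.

(** * Double counting and Mantel's theorem *)

Lemma sum_mem_card (I : finType) (P : {pred I}) : \sum_i (i \in P) = #|P|.
Proof. by rewrite -sum1_card [RHS]big_mkcond; apply: eq_bigr => i _; case: (i \in P). Qed.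

Lemma sum_bool_unique (I : finType) (A : {set I}) (F : pred I) :
  (forall i j, i \in A -> j \in A -> F i -> F j -> i = j) ->
  \sum_(i in A) F i <= [exists i in A, F i].
Proof.
move=> inj; have [/exists_inP[i iA Fi]|/exists_inPn nF] := boolP [exists i in A, F i]; last first.
  by rewrite big1 // => i /nF/negPf->.
rewrite (bigD1 i) //= Fi big1 // => j /andP[jA ji].
by case Fj: (F j) => //; case/eqP: ji; apply: inj.
Qed.

(** Every related pair is counted from both ends: the left side is the sum of [f x + f y] over the
    ordered related pairs. *)
Lemma sum_symmetric_rel (I : finType) (R : rel I) (f : I -> nat) c : symmetric R ->
  (forall x y, R x y -> f x + f y <= c) ->
  2 * (\sum_x (\sum_y R x y) * f x) <= c * \sum_x \sum_y R x y.
Proof.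
move=> R_sym Rf; rewrite mul2n -addnn.
have -> : \sum_x (\sum_y R x y) * f x = \sum_x \sum_y R x y * f x.
  by apply: eq_bigr => x _; rewrite big_distrl.
rewrite [X in X + _]exchange_big -big_split big_distrr leq_sum //= => x _.
rewrite -big_split big_distrr leq_sum //= => y _.
by rewrite R_sym -mulnDr; case Rxy: (R x y); rewrite ?muln0 ?muln1 ?mul1n // Rf // R_sym.
Qed.

(** Ordered pairs count every edge twice, hence a half of [#|A| ^ 2] instead of a quarter. Adjacent
    vertices have disjoint neighbourhoods in [A], so their degrees sum to at most [#|A|]. *)
Lemma mantel (I : finType) (R : rel I) (A : {set I}) : symmetric R ->
  (forall x y z, R x y -> R x z -> R y z -> False) ->
  \sum_(x in A) \sum_(y in A) R x y <= (#|A| * #|A|) %/ 2.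
Proof.
move=> R_sym R_tri; set N := #|A|.
pose S x y := [&& R x y, x \in A & y \in A].
have S_sym : symmetric S by move=> x y; rewrite /S R_sym [X in _ && X]andbC.
pose d x := \sum_y S x y.
have <- : \sum_x d x = \sum_(x in A) \sum_(y in A) R x y.
  rewrite [RHS]big_mkcond; apply: eq_bigr => x _; rewrite /d /S; case: (x \in A); last first.
    by rewrite big1 // => y _; rewrite andbF.
  by rewrite [RHS]big_mkcond; apply: eq_bigr => y _; case: (y \in A); rewrite ?andbT ?andbF.
have dN x y : S x y -> d x + d y <= N.
  case/and3P=> Rxy _ _; rewrite -big_split /N -sum_mem_card leq_sum // => z _.
  rewrite /S /=; case Rxz: (R x z); case Ryz: (R y z) => //=.
  - by case: (R_tri x y z).
  - by case: (z \in A); rewrite ?andbF // andbT addn0; case: (x \in A).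
  - by case: (z \in A); rewrite ?andbF // andbT; case: (y \in A).
have Q : 2 * (\sum_x d x * d x) <= N * \sum_x d x := sum_symmetric_rel S_sym dN.
(* Summing [(2 * d x - N) ^ 2 >= 0] over [A]. *)
have : \sum_(x in A) 4 * (N * d x) <= \sum_(x in A) (4 * (d x * d x) + N * N).
  by apply: leq_sum => x _; have [+ _] := nat_Cauchy (2 * d x) N; rewrite -!mulnn; lia.
have dA f : (forall x, d x = 0 -> f x = 0) -> \sum_(x in A) f x = \sum_x f x.
  move=> f0; rewrite big_mkcond; apply: eq_bigr => x _; case: ifPn => // xA.
  by rewrite f0 // /d big1 // => y _; rewrite /S (negPf xA) andbF.
rewrite [X in _ <= X]big_split /= sum_nat_const -/N !dA; try by move=> x ->; rewrite ?muln0.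
rewrite -!big_distrr /=; set e := \sum_x d x in Q *.
have [N0 _|N0] := posnP N; last by move=> H; rewrite leq_divRL // -(leq_pmul2l N0); lia.
rewrite /e big1 // => x _; apply: big1 => y _.
by case Sxy: (S x y) => //; case/and3P: Sxy => _ xA _; move: N0; rewrite /N (cardD1 x) xA.
Qed.

(** * Numerical part of the upper bound *)

(* Meaningful only for [m >= 4]. *)
Definition max_triangles m :=
  if m <= 5 then 4 else if m == 6 then 5 else if m == 7 then 8 else m ^ 2 %/ 8.

(* [k] K4's leave [N] vertices uncovered, and [P] is the sum of [r v * (r v - 1)]. *)
Definition small_case_ok m k P N :=
  let b := (k * (m + 8) + k * N + (N * N) %/ 2 - (12 * k + 3 * P)) %/ 4 in
  [|| 2 * m + P < 2 * N + 8 * k, k * (m + 8) < 12 * k + 3 * P |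
    (4 * k <= max_triangles m) &&
   [|| 4 * k + b <= max_triangles m, k + N < 3,
      (k + N == 3) && (0 < P) |
      [&& k + N == 3, 0 < N & 4 * k + (k * N + (N * N) %/ 2) <= max_triangles m]]].

Lemma small_cases : all (fun m => all (fun k => all (fun P => all (small_case_ok m k P)
  (iota 0 16)) (iota 0 23)) (iota 0 7)) (iota 4 12).
Proof. by vm_compute. Qed.

(** [b] stands for the number of book triangles. The first two disjuncts of [small_case_ok] discard
    parameters violating the hypotheses; where the counting bound is too weak, [k + N <= 3] and the
    last hypothesis decides. *)
Lemma small_bound n k P N b : 4 <= n < 16 -> N <= n -> 2 * N + 8 * k <= 2 * n + P ->
  12 * k + 3 * P <= k * (n + 8) ->
  4 * b + 12 * k + 3 * P <= k * (n + 8) + k * N + (N * N) %/ 2 ->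
  (0 < b -> k + N <= 3 ->
   [/\ k + N = 3, P = 0 & 0 < N -> b <= k * N + (N * N) %/ 2]) ->
  4 * k + b <= max_triangles n.
Proof.
move=> /andP[n4 n16] Nn wN kP b4 few.
(* The hypotheses give [3 * P <= k * (n - 4)] and [k * (28 - n) <= 6 * n]; for [n <= 15] this means
   [k <= 6] and [P <= 22]. *)
have [k7 P23] : k < 7 /\ P < 23.
  have : n \in iota 4 12 by rewrite mem_iota n4 n16.
  rewrite !inE; do 11?[case/orP]; move/eqP=> e; subst n; lia.
move: small_cases => /allP/(_ n); rewrite mem_iota n4 n16 => /(_ isT).
move=> /allP/(_ k); rewrite mem_iota k7 => /(_ isT).
move=> /allP/(_ P); rewrite mem_iota P23 => /(_ isT).
move=> /allP/(_ N); rewrite mem_iota (leq_ltn_trans Nn n16) => /(_ isT).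
rewrite /small_case_ok; move: (max_triangles n) => M.
move: b4 few; move: (_ %/ 2) (k * N) => N2 kN b4 few.
move=> ok; have {ok} [kM ok] : 4 * k <= M /\
  [|| 4 * k + (k * (n + 8) + kN + N2 - (12 * k + 3 * P)) %/ 4 <= M, k + N < 3,
      (k + N == 3) && (0 < P) | [&& k + N == 3, 0 < N & 4 * k + (kN + N2) <= M]].
  by case/or3P: ok => [||/andP[]//]; rewrite ltnNge ?wN ?kP.
have [->|b0] := posnP b; first by rewrite addn0.
have few0 := few b0; case/or4P: ok => [|kN3|/andP[/eqP kN3 P0]|/and3P[/eqP kN3 N0 le]].
- apply: leq_trans; rewrite leq_add2l leq_divRL // leq_subRL //; last by lia.
  by rewrite mulnC; lia.
- by have [] := few0 (ltnW kN3) => e; rewrite e in kN3.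
- by have [] := few0 (eq_leq kN3) => _ e; rewrite e in P0.
- have [_ _ bN] := few0 (eq_leq kN3).
  by apply: leq_trans le; rewrite leq_add2l bN.
Qed.

Lemma large_bound n k s b :
  16 <= n -> 4 * b <= s ->
  (forall c, 16 * c * (s + 12 * k) <= 32 * n * s + 192 * k * (n + 8) + c * c * n) ->
  4 * k + b <= n ^ 2 %/ 8.
Proof.
move=> n16 bs wd; rewrite leq_divRL // -mulnn.
have [n24|n24] := leqP 24 n.
  (* [c / 8] plays the role of the mean of [D], which is about [n / 2] in the extremal graph. *)
  have {}wd := wd (4 * n).
  have nk : 24 * k <= n * k by rewrite leq_mul2r n24 orbT.
  have : n * (2 * s + 32 * k) <= n * (n * n) by lia.
  by rewrite leq_pmul2l; lia.
(* This [c] makes the coefficients of [s / 4] and [4 k] equal. *)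
have {}wd := wd (5 * n - 24).
have : n \in iota 16 8 by rewrite mem_iota n16.
by rewrite !inE; do 7?[case/orP]; move/eqP=> e; subst n; lia.
Qed.

(** * K4's and book triangles under P4-free links *)

Section Structure.
Variables (V : finType) (g : rel V).
Hypothesis g_sym : symmetric g.
Hypothesis g_irr : irreflexive g.

Definition clique (A : {set V}) : bool :=
  [forall x in A, forall y in A, (x != y) ==> g x y].

Definition link_P4_free : Prop := forall v a b c d,
  uniq [:: v; a; b; c; d] -> g v a -> g v b -> g v c -> g v d ->
  g a b -> g b c -> g c d -> False.
Hypothesis g_free : link_P4_free.

Lemma cliqueP A x y : clique A -> x \in A -> y \in A -> x != y -> g x y.
Proof. by move=> /forall_inP cA /cA/forall_inP Ax /Ax/implyP; apply. Qed.

Lemma neq_adj x y : g x y -> x != y.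
Proof. by apply: contraTneq => ->; rewrite g_irr. Qed.

Definition K4s : {set {set V}} := [set K : {set V} | (#|K| == 4) && clique K].

(** If [a] and [b] differed, with [c], [d] the rest of [K], the link of [a] would contain the path
    [x b c d]. *)
Lemma K4_outside_adj K x a b : K \in K4s -> x \notin K -> a \in K -> b \in K ->
  g x a -> g x b -> a = b.
Proof.
rewrite inE => /andP[/eqP K4 cK] xK aK bK xa xb.
apply/eqP/negPn/negP => ab.
have : #|K :\ a :\ b| == 2.
  by have := cardsD1 a K; have := cardsD1 b (K :\ a); rewrite aK K4 !inE eq_sym ab bK /=; lia.
case/cards2P=> [c [d [cd Kcd]]].
have /setD1P[cb /setD1P[ca cK']] : c \in K :\ a :\ b by rewrite Kcd !inE eqxx.
have /setD1P[db /setD1P[da dK']] : d \in K :\ a :\ b by rewrite Kcd !inE eqxx orbT.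
have xN y : y \in K -> x != y by apply: contraTneq => <-.
have un : uniq [:: a; x; b; c; d].
  by rewrite /= !inE !negb_or !(eq_sym a) xN // (eq_sym b a) ab ca da !xN // !(eq_sym b) cb db cd.
by apply: (g_free un); first [done | by rewrite g_sym | by apply: (cliqueP cK); rewrite // eq_sym].
Qed.

(** A vertex of [K'] outside [K] would be adjacent to both [a] and [b]. *)
Lemma K4_meet K K' a b : K \in K4s -> K' \in K4s ->
  a \in K -> b \in K -> a \in K' -> b \in K' -> a != b -> K = K'.
Proof.
move=> KK KK' aK bK aK' bK' ab; apply/eqP/negPn/negP => KnK'.
have [] := boolP (K' \subset K) => [sub|/subsetPn[x xK' xK]].
  case/negP: KnK'; rewrite eq_sym eqEcard sub.
  by move: KK KK'; rewrite !inE => /andP[/eqP-> _] /andP[/eqP-> _].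
have cK' : clique K' by move: KK'; rewrite inE => /andP[].
have xN y : y \in K -> x != y by apply: contraTneq => <-.
by case/eqP: ab; apply: (K4_outside_adj KK xK); rewrite ?(cliqueP cK') ?xN.
Qed.

Definition books : {set {set V}} :=
  [set T : {set V} | [&& #|T| == 3, clique T & [forall K in K4s, ~~ (T \subset K)]]].

Lemma book_K4_meet T K a b : T \in books -> K \in K4s ->
  a \in T -> b \in T -> a \in K -> b \in K -> a = b.
Proof.
rewrite inE => /and3P[_ cT /forall_inP nT] KK aT bT aK bK.
have /subsetPn[z zT zK] := nT _ KK.
have zN y : y \in K -> z != y by apply: contraTneq => <-.
by apply: (K4_outside_adj KK zK); rewrite ?(cliqueP cT) ?zN.
Qed.

(** * Apexes and legs *)

Definition is_apex (T : {set V}) (z : V) : bool :=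
  (z \in T) && [forall w, forall y in T,
    (w \notin T) && (y != z) ==> ~~ (g w z && g w y)].

Lemma set3_third (T : {set V}) x y : #|T| = 3 -> x \in T -> y \in T -> x != y ->
  exists z, [/\ z != x, z != y & T = [set x; y; z]].
Proof.
move=> T3 xT yT xy.
have : #|T :\ x :\ y| == 1.
  by have := cardsD1 x T; have := cardsD1 y (T :\ x); rewrite xT T3 !inE eq_sym xy yT /=; lia.
case/cards1P=> z Tz.
have /setD1P[zy /setD1P[zx zT]] : z \in T :\ x :\ y by rewrite Tz inE.
exists z; split=> //; apply/setP=> u; move/setP/(_ u): Tz; rewrite !inE.
have [->|_] := eqVneq u x; first by rewrite xT.
have [->|_] /= := eqVneq u y; first by rewrite yT.
by move=> ->.
Qed.

(* Otherwise the link of [u] contains the path [w y z w'], or [w = w'] makes a K4. *)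
Lemma book_codegree T u y z w w' : T \in books -> T = [set u; y; z] ->
  u != y -> u != z -> y != z -> w \notin T -> w' \notin T ->
  g w u -> g w y -> g w' u -> g w' z -> False.
Proof.
move=> TB defT uy uz yz wT w'T wu wy w'u w'z.
have [cT nT] : clique T /\ forall K, K \in K4s -> ~~ (T \subset K).
  by move: TB; rewrite inE => /and3P[_ ? /forall_inP].
have [uT yT zT] : [/\ u \in T, y \in T & z \in T] by rewrite defT !inE !eqxx !orbT.
have wN v : v \in T -> w != v by apply: contraTneq => <-.
have w'N v : v \in T -> w' != v by apply: contraTneq => <-.
have [ww'|ww'] := eqVneq w w'.
  subst w'; have /nT/negP[] : w |: T \in K4s; last by rewrite subsetUr.
  rewrite inE cardsU1 wT; move: TB; rewrite inE => /and3P[/eqP-> _ _] /=.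
  have aux v : v \in T -> g w v by rewrite defT !inE -orbA => /or3P[] /eqP->.
  apply/forall_inP=> a /setU1P aT; apply/forall_inP=> b /setU1P bT; apply/implyP=> ab.
  case: aT bT ab => [->|aT] [->|bT] ab; rewrite ?eqxx // in ab *.
  - exact: aux.
  - by rewrite g_sym aux.
  - exact: (cliqueP cT).
have un : uniq [:: u; w; y; z; w'].
  by rewrite /= !inE !negb_or uy uz yz ww' !wN // eq_sym wN // !(eq_sym _ w') !w'N.
by apply: (g_free un); first [done | by rewrite g_sym | by apply: (cliqueP cT)].
Qed.

(** By [book_codegree] at most one side of [T] lies in another triangle; the vertex opposite to that
    side is an apex. *)
Lemma book_has_apex T : T \in books -> exists z, is_apex T z.
Proof.
move=> TB; have [T3 cT] : #|T| = 3 /\ clique T.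
  by move: TB; rewrite inE => /and3P[/eqP].
have /card_gt0P[x xT] : 0 < #|T| by rewrite T3.
have [|] := boolP (is_apex T x) => [|nx]; first by exists x.
move: nx; rewrite /is_apex xT /= => /forallPn[w] /forall_inPn[y yT].
rewrite negb_imply negbK => /andP[/andP[wT yx] /andP[wx wy]].
rewrite eq_sym in yx.
have [z [zx zy defT]] := set3_third T3 xT yT yx.
exists z; rewrite /is_apex {1}defT !inE eqxx orbT /=.
apply/forallP=> w'; apply/forall_inP=> u uT; apply/implyP=> /andP[w'T uz].
apply/negP=> /andP[w'z w'u].
rewrite eq_sym in zx; rewrite eq_sym in zy.
move: uT uz w'u; rewrite {1}defT !inE -orbA => /or3P[] /eqP-> uz w'u.
- exact: (book_codegree TB defT _ _ _ wT w'T wx wy w'u w'z).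
- have defT' : T = [set y; x; z] by rewrite [[set y; x]]setUC.
  by apply: (book_codegree TB defT' _ zy zx wT w'T wy wx w'u w'z); rewrite eq_sym.
- by rewrite eqxx in uz.
Qed.

(** A book triangle with no side in another triangle has three apexes; picking one leaves it exactly
    two legs. *)
Definition apex T := [pick z | is_apex T z].

Lemma apexP T : T \in books -> exists2 z, apex T = Some z & is_apex T z.
Proof.
move=> /book_has_apex[z0 z0P]; rewrite /apex; case: pickP => [z zP|/(_ z0)]; first by exists z.
by rewrite z0P.
Qed.

Definition leg (T : {set V}) (x y : V) : bool :=
  [&& x \in T, y \in T, x != y & (apex T == Some x) || (apex T == Some y)].

Definition legs (x y : V) : bool := [exists T in books, leg T x y].

Lemma leg_sym T : symmetric (leg T).
Proof. by move=> x y; rewrite /leg eq_sym andbCA [X in [&& _, _, _ & X]]orbC. Qed.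

Lemma legs_sym : symmetric legs.
Proof. by move=> x y; apply: eq_existsb => T; rewrite leg_sym. Qed.

Lemma leg_private T x y w : T \in books -> leg T x y -> g w x -> g w y -> w \in T.
Proof.
move=> TB; wlog ax : x y / apex T = Some x.
  move=> wl /[dup] /and4P[_ _ _ /orP[] /eqP ax]; first exact: wl.
  by rewrite leg_sym => lg wx wy; apply: (wl y x).
move=> /and4P[xT yT xy _] wx wy.
have [_ [<-] /andP[_ /forallP/(_ w)/forall_inP/(_ y yT)/implyP]] : exists2 z, Some x = Some z & is_apex T z.
  by rewrite -ax; apply: apexP.
by rewrite eq_sym xy andbT wx wy; case: (w \in T) => // /(_ isT).
Qed.

Lemma leg_inj T T' x y : T \in books -> T' \in books -> leg T x y -> leg T' x y -> T = T'.
Proof.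
move=> TB T'B lT /and4P[xT' yT' xy _].
have [xT yT] : x \in T /\ y \in T by case/and4P: lT.
have [T3 _] : #|T| = 3 /\ clique T by move: TB; rewrite inE => /and3P[/eqP].
have [T'3 cT'] : #|T'| = 3 /\ clique T' by move: T'B; rewrite inE => /and3P[/eqP].
apply/eqP; rewrite eq_sym eqEcard T3 T'3 leqnn andbT; apply/subsetP=> w wT'.
have [->//|wx] := eqVneq w x; have [->//|wy] := eqVneq w y.
by apply: (leg_private TB lT); apply: (cliqueP cT').
Qed.

Lemma legs_adj x y : legs x y -> g x y.
Proof.
case/exists_inP=> T; rewrite inE => /and3P[_ cT _] /and4P[xT yT xy _].
exact: (cliqueP cT).
Qed.

Definition K4_edge (x y : V) : bool := [exists K in K4s, [&& x \in K, y \in K & x != y]].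

Definition used (x y : V) : bool := legs x y || K4_edge x y.

Lemma legs_K4 x y : legs x y -> ~~ K4_edge x y.
Proof.
case/exists_inP=> T TB /and4P[xT yT xy _]; apply/exists_inPn => K KK.
by apply/negP => /and3P[xK yK _]; case/eqP: xy; apply: (book_K4_meet TB KK).
Qed.

Lemma K4_edge_adj x y : K4_edge x y -> g x y.
Proof.
by case/exists_inP=> K; rewrite inE => /andP[_ cK] /and3P[? ? ?]; apply: (cliqueP cK).
Qed.

Lemma used_adj x y : used x y -> g x y.
Proof. by case/orP => [/legs_adj|/K4_edge_adj]. Qed.

Lemma used_irr x : used x x = false.
Proof. by apply: contraFF (g_irr x); apply: used_adj. Qed.

(* The third side of the book triangle on [x y] is its spine, which is not [used]. *)
Lemma legs_no_common x y z : legs x y -> used x z -> used y z -> False.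
Proof.
case/exists_inP=> T TB; wlog ax : x y / apex T = Some x.
  move=> wl /[dup] /and4P[_ _ _ /orP[] /eqP ax]; first exact: wl.
  by rewrite leg_sym => lg xz yz; apply: (wl y x).
move=> lT xz yz.
have gxz := used_adj xz; have gyz := used_adj yz.
have zT : z \in T by apply: (leg_private TB lT); rewrite g_sym.
have [xT yT xy _] := and4P lT.
have zx : z != x by rewrite eq_sym neq_adj.
have zy : z != y by rewrite eq_sym neq_adj.
have cT : clique T by move: TB; rewrite inE => /and3P[].
case/orP: yz => [/exists_inP[T' T'B lT']|/exists_inP[K KK /and3P[yK zK _]]]; last first.
  by case/eqP: zy; apply: (book_K4_meet TB KK).
(* The spine [yz] is no leg of another book triangle either: [T'] would contain [x], hence equal
   [T]. *)
have xT' : x \in T' by apply: (leg_private T'B lT'); rewrite // (cliqueP cT).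
have defT : T = T'.
  have [T3 T'3] : #|T| = 3 /\ #|T'| = 3.
    by move: TB T'B; rewrite !inE => /and3P[/eqP? _ _] /and3P[/eqP? _ _].
  have [yT' zT' _ _] := and4P lT'.
  apply/eqP; rewrite eqEcard T3 T'3 leqnn andbT.
  have [u [ux uy defT]] := set3_third T3 xT yT xy.
  have /eqP zu : z == u by move: zT; rewrite {1}defT !inE (negPf zx) (negPf zy).
  by apply/subsetP => w; rewrite {1}defT -zu !inE -orbA => /or3P[]/eqP->.
move: lT'; rewrite -defT => /and4P[_ _ _]; rewrite ax => /orP[] /eqP[] e.
  by rewrite e eqxx in xy.
by rewrite e eqxx in zx.
Qed.

(** * Weighted degrees *)

Definition leg_deg (v : V) : nat := \sum_y legs v y.
Local Notation s := leg_deg.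
Definition K4_deg (v : V) : nat := \sum_(K in K4s) (v \in K).
Local Notation r := K4_deg.
Local Notation D v := (s v + 3 * r v).
Local Notation n := #|V|.
Local Notation k := #|K4s|.
Local Notation P := (\sum_v r v * (r v).-1).
Local Notation W := [set v | r v == 0].

Lemma card_K4 K : K \in K4s -> #|K| = 4.
Proof. by rewrite inE => /andP[/eqP]. Qed.

Lemma sum_K4_deg (f : V -> nat) : \sum_v r v * f v = \sum_(K in K4s) \sum_(v in K) f v.
Proof.
under eq_bigr => v _ do rewrite big_distrl /=.
rewrite exchange_big; apply: eq_bigr => K _; rewrite [RHS]big_mkcond; apply: eq_bigr => v _.
by case: (v \in K); rewrite ?mul1n.
Qed.

Lemma sum_r : \sum_v r v = 4 * k.
Proof.
transitivity (\sum_v r v * 1); first by apply: eq_bigr => v _; rewrite muln1.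
rewrite sum_K4_deg (eq_bigr (fun=> 4)); last by move=> K /card_K4 <-; rewrite sum1_card.
by rewrite sum_nat_const mulnC.
Qed.

Lemma K4_outside_used K y : K \in K4s -> y \notin K -> \sum_(a in K) used a y <= 1.
Proof.
move=> KK yK; apply: leq_trans (sum_bool_unique _) _; last exact: leq_b1.
by move=> a b aK bK /used_adj ay /used_adj b_y; apply: (K4_outside_adj KK yK); rewrite // g_sym.
Qed.

(** There are 12 ordered pairs inside [K], and each of the [n - 4] other vertices adds at most
    one. *)
Lemma K4_used K : K \in K4s -> \sum_(a in K) \sum_y used a y <= n + 8.
Proof.
move=> KK; have -> : n + 8 = \sum_y (1 + 2 * (y \in K)).
  by rewrite big_split -big_distrr /= sum_mem_card card_K4 // sum1_card.
rewrite exchange_big leq_sum //= => y _.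
have [yK|/(K4_outside_used KK)] := boolP (y \in K); last by rewrite muln0.
rewrite (bigD1 y) //= used_irr add0n.
have <- : \sum_(a in K :\ y) 1 = 1 + 2 * true.
  by rewrite sum1_card; have := cardsD1 y K; rewrite yK card_K4 //; lia.
rewrite [leqRHS](eq_bigl (fun a => (a \in K) && (a != y))).
  by apply: leq_sum => a _; apply: leq_b1.
by move=> a; rewrite !inE andbC.
Qed.

(** K4's through [v] pairwise share only [v], and no leg is a K4 edge, so [D v] counts no [used]
    edge twice. *)
Lemma D_used v : D v <= \sum_y used v y.
Proof.
have -> : 3 * r v = \sum_y \sum_(K in K4s) [&& v \in K, y \in K & v != y].
  rewrite exchange_big /r big_distrr; apply: eq_bigr => K KK /=.
  have [vK|_] := boolP (v \in K); last by rewrite big1.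
  transitivity #|K :\ v|; first by have := cardsD1 v K; rewrite vK card_K4 //; lia.
  by rewrite -sum_mem_card; apply: eq_bigr => y _; rewrite !inE andbC eq_sym.
rewrite -big_split leq_sum //= => y _; rewrite /used.
have -> : legs v y || K4_edge v y = legs v y + K4_edge v y :> nat.
  by case L: (legs v y) => //; rewrite (negPf (legs_K4 L)).
rewrite leq_add2l.
apply: (sum_bool_unique (F := fun K : {set V} => [&& v \in K, y \in K & v != y])).
move=> K K' KK KK' /and3P[vK yK vy] /and3P[vK' yK' _].
exact: (K4_meet KK KK' vK yK).
Qed.

Lemma sum_r_D : \sum_v r v * D v <= k * (n + 8).
Proof.
rewrite sum_K4_deg -sum_nat_const leq_sum // => K KK.
by apply: leq_trans (K4_used KK); apply: leq_sum => v _; apply: D_used.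
Qed.

(** The ends of a leg have no common neighbour along [used] edges, so [D x + D y <= n]. *)
Lemma sum_s_D : 2 * (\sum_v s v * D v) <= n * \sum_v s v.
Proof.
apply: (sum_symmetric_rel (f := fun v => D v) legs_sym) => x y lxy.
apply: leq_trans (leq_add (D_used x) (D_used y)) _.
rewrite -big_split -sum1_card leq_sum //= => z _.
case xz: (used x z); case yz: (used y z) => //.
by case: (legs_no_common lxy xz yz).
Qed.

(** * Counting book triangles by their legs *)

Lemma book_card T : T \in books -> #|T| = 3.
Proof. by rewrite inE => /and3P[/eqP]. Qed.

Lemma book_other T x : T \in books -> x \in T -> exists2 y, y \in T & x != y.
Proof.
move=> TB xT; have /card_gt0P[y /setD1P[yx yT]] : 0 < #|T :\ x|.
  by have := cardsD1 x T; rewrite xT book_card //; lia.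
by exists y; rewrite // eq_sym.
Qed.

Lemma sum_leg T : T \in books -> 4 <= \sum_x \sum_y leg T x y.
Proof.
move=> TB; rewrite pair_bigA /=.
have [z az /andP[zT _]] := apexP TB.
have [y yT zy] := book_other TB zT.
have [w [wz wy defT]] := set3_third (book_card TB) zT yT zy.
have wT : w \in T by rewrite defT !inE eqxx orbT.
pose L := [set p | leg T p.1 p.2].
have -> : \sum_p leg T p.1 p.2 = #|L|.
  by rewrite -sum_mem_card; apply: eq_bigr => p _; rewrite inE.
apply/card_geqP; exists [:: (z, y); (z, w); (y, z); (w, z)]; split=> //.
  have [yz zw yw] : [/\ y != z, z != w & y != w] by rewrite ![_ == w]eq_sym eq_sym.
  by rewrite /= !inE !xpair_eqE !eqxx !(negPf zy, negPf yz, negPf wz, negPf zw, negPf wy, negPf yw).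
move=> p; rewrite !inE => /or4P[] /eqP-> /=; rewrite /leg az eqxx ?orbT zT ?yT ?wT //=.
- by rewrite andbT zy.
- by rewrite andbT eq_sym.
- by rewrite andbT eq_sym.
- by rewrite andbT.
Qed.

Lemma sum_books_leg x y : \sum_(T in books) leg T x y <= legs x y.
Proof. by apply: sum_bool_unique => T T' TB T'B; apply: leg_inj. Qed.

(** The factor 4 comes from two legs in both orders; an ordered pair is a leg of at most one book
    triangle. *)
Lemma books_le_s : 4 * #|books| <= \sum_v s v.
Proof.
rewrite mulnC -sum_nat_const; apply: leq_trans (leq_sum _ sum_leg) _.
rewrite exchange_big leq_sum //= => x _; rewrite exchange_big leq_sum //= => y _.
exact: sum_books_leg.
Qed.

(** Each vertex of a book triangle is on a leg of it, being the apex or joined to the apex by a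
    leg. *)
Lemma books_le_s1 x : (forall T, T \in books -> x \in T) -> #|books| <= s x.
Proof.
move=> xT; apply: (@leq_trans (\sum_(T in books) \sum_y leg T x y)); last first.
  by rewrite exchange_big leq_sum //= => y _; apply: sum_books_leg.
rewrite -sum1_card leq_sum // => T TB.
have [y lxy] : exists y, leg T x y; last by rewrite (bigD1 y) //= lxy.
have [z az /andP[zT _]] := apexP TB.
have [zx|zx] := eqVneq x z.
  have [y yT xy] := book_other TB (xT T TB).
  by exists y; rewrite /leg xT // yT xy az zx eqxx.
by exists z; rewrite /leg xT // zT zx az eqxx orbT.
Qed.

Lemma card_triangles_le :
  #|[set T : {set V} | (#|T| == 3) && clique T]| <= 4 * k + #|books|.
Proof.
pose F (K T : {set V}) := (T \subset K) && (#|T| == 3).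
have -> : 4 * k = \sum_(K in K4s) \sum_T F K T.
  rewrite mulnC -sum_nat_const; apply: eq_bigr => K KK.
  transitivity 'C(#|K|, 3); first by rewrite card_K4.
  rewrite -cards_draws -sum_mem_card; apply: eq_bigr => T _.
  by rewrite inE.
rewrite exchange_big -!sum_mem_card -big_split leq_sum //= => T _.
rewrite inE; have [T3|//] := boolP (#|T| == 3); have [cT|//] /= := boolP (clique T).
have [TB|] := boolP (T \in books); first by rewrite addn1.
rewrite inE T3 cT /= => /forall_inPn[K KK]; rewrite negbK => TK.
by rewrite (bigD1 K) //= /F TK T3.
Qed.

(** * Covered and uncovered vertices *)

Lemma sum_sqr_r : \sum_v r v * r v = 4 * k + P.
Proof. by rewrite -sum_r -big_split; apply: eq_bigr => v _; case: (r v) => //= m; lia. Qed.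

(** The left side is at most the sum of [r v * D v]: outside [W], [s v <= r v * s v], and
    [12 * k + 3 * P] is the sum of [3 * r v ^ 2]. *)
Lemma sum_s_covered : \sum_(v in ~: W) s v + 12 * k + 3 * P <= k * (n + 8).
Proof.
apply: leq_trans sum_r_D; rewrite -addnA -[12]/(3 * 4) -mulnA -mulnDr -sum_sqr_r.
rewrite big_distrr [X in X + _]big_mkcond -big_split leq_sum //= => v _.
by rewrite !inE; case: (r v) => //= m; nia.
Qed.

Lemma legs_covered v : r v = 0 -> \sum_(y in ~: W) legs v y <= k.
Proof.
move=> rv; apply: (@leq_trans (\sum_y r y * legs v y)).
  by rewrite big_mkcond leq_sum //= => y _; rewrite !inE; case: (r y) => //= m; nia.
rewrite sum_K4_deg -sum1_card leq_sum // => K KK.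
have vK : v \notin K.
  by apply: contra_eqN rv => vK; rewrite /r (bigD1 K) //= vK.
apply: leq_trans (K4_outside_used KK vK); apply: leq_sum => a _.
by rewrite /used legs_sym; case: (legs a v).
Qed.

Lemma sum_s_uncovered : \sum_(v in W) s v <= k * #|W| + (#|W| * #|W|) %/ 2.
Proof.
have M : \sum_(v in W) \sum_(y in W) legs v y <= (#|W| * #|W|) %/ 2.
  apply: mantel legs_sym _ => x y z xy xz yz.
  by apply: (legs_no_common xy (z := z)); rewrite /used ?xz ?yz.
apply: leq_trans (leq_add (leqnn _) M); rewrite mulnC -sum_nat_const.
rewrite -big_split leq_sum //= => v; rewrite inE => /eqP rv.
have -> : s v = \sum_(y in ~: W) legs v y + \sum_(y in W) legs v y.
  by rewrite /s (bigID (mem W)) addnC /=; congr (_ + _); apply: eq_bigl => y; rewrite in_setC.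
by rewrite leq_add2r legs_covered.
Qed.

(** Summed over the vertices; where [r v > 0] the inequality is [(r v - 1) * (r v - 2) >= 0]. *)
Lemma card_uncovered : 2 * #|W| + 8 * k <= 2 * n + P.
Proof.
have -> : 8 * k = 2 * \sum_v r v by rewrite sum_r; lia.
rewrite -sum1_card -[n]sum1_card !big_distrr big_mkcond -!big_split leq_sum //= => v _.
by rewrite inE; case: (r v) => //= m; nia.
Qed.

(* [T] meets each K4 at most once, so its three vertices are accounted for by
   the K4's and the uncovered vertices; if these are only three in number,
   every vertex of [T] lies in at most one K4 and every K4 meets [T].  Were [v]
   common to [K] and [K'], the vertex of [T] in [K] would be adjacent to both [v]
   and the vertex of [T] in [K']. *)
Lemma book_few T : T \in books -> k + #|W| <= 3 ->
  [/\ k + #|W| = 3, P = 0 & W \subset T].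
Proof.
move=> TB kW.
have cT : clique T by move: TB; rewrite inE => /and3P[].
have TK K : K \in K4s -> #|T :&: K| <= 1.
  move=> KK; apply/card_le1_eqP => a b /setIP[aT aK] /setIP[bT bK].
  exact: (book_K4_meet TB KK).
have sumTK : \sum_(K in K4s) #|T :&: K| <= k.
  by rewrite -sum1_card leq_sum.
have sum_rT : \sum_(v in T) r v = \sum_(K in K4s) #|T :&: K|.
  rewrite exchange_big; apply: eq_bigr => K _; rewrite -sum_mem_card big_mkcond.
  by apply: eq_bigr => v _; rewrite inE; case: (v \in T).
have sum_WT : \sum_(v in T) (r v == 0) = #|T :&: W|.
  rewrite -sum_mem_card big_mkcond.
  by apply: eq_bigr => v _; rewrite !inE; case: (v \in T).
have WT : #|T :&: W| <= #|W| by rewrite subset_leq_card ?subsetIr.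
have ge1 v : 1 <= r v + (r v == 0) by case: (r v).
have sum3 : \sum_(v in T) (r v + (r v == 0)) = \sum_(K in K4s) #|T :&: K| + #|T :&: W|.
  by rewrite big_split /= sum_rT sum_WT.
have ge3 : 3 <= \sum_(v in T) (r v + (r v == 0)).
  by rewrite -(book_card TB) -sum1_card leq_sum.
(* The left sum in [sum3] has three terms, each at least 1, and is at most [k + #|W| <= 3]; so every
   estimate is tight. *)
have r1 v : v \in T -> r v <= 1.
  move=> vT; have e : \sum_(u in T) (r u + (r u == 0)) =
    r v + (r v == 0) + \sum_(u in T :\ v) (r u + (r u == 0)) := big_setD1 _ vT.
  have : #|T :\ v| <= \sum_(u in T :\ v) (r u + (r u == 0)) by rewrite -sum1_card leq_sum.
  have := cardsD1 v T; rewrite vT book_card //; move: sum3; rewrite {}e.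
  move: (\sum_(u in T :\ v) _) #|T :\ v| (r v == 0); lia.
have TK1 K : K \in K4s -> exists2 a, a \in T & a \in K.
  move=> KK; suff /card_gt0P[a /setIP[aT aK]] : 0 < #|T :&: K| by exists a.
  have e : \sum_(L in K4s) #|T :&: L| =
    #|T :&: K| + \sum_(L in K4s :\ K) #|T :&: L| := big_setD1 _ KK.
  have : \sum_(L in K4s :\ K) #|T :&: L| <= #|K4s :\ K|.
    by rewrite -sum1_card leq_sum // => L /setD1P[_ /TK].
  have := cardsD1 K K4s; rewrite KK; move: ge3; rewrite sum3 {}e.
  move: (\sum_(L in K4s :\ K) _) #|K4s :\ K|; lia.
split; first by lia.
  apply/eqP; rewrite sum_nat_eq0; apply/forallP => v /=; apply: contraT => rv.
  have [K KK vK] : exists2 K, K \in K4s & v \in K.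
    apply/exists_inP; apply: contraT => /exists_inPn nK.
    by case/negP: rv; rewrite /r big1 // => K /nK/negPf->.
  have [K' /andP[KK' K'K] vK'] : exists2 K', (K' \in K4s) && (K' != K) & v \in K'.
    apply/exists_inP; apply: contraT => /exists_inPn nK.
    case/negP: rv; rewrite /r (bigD1 K) //= vK big1 // => K' KK'.
    by rewrite (negPf (nK _ KK')).
  have two u : u \in K -> u \in K' -> 1 < r u.
    by move=> uK uK'; rewrite /r (bigD1 K) // (bigD1 K') ?KK' // uK uK'.
  have [[a aT aK] [b bT bK']] := (TK1 _ KK, TK1 _ KK').
  have aK' : a \notin K' by apply/negP => /(two _ aK); rewrite ltnNge r1.
  have ab : a != b by apply: contraNneq aK' => ->.
  have cK : clique K by move: KK; rewrite inE => /andP[].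
  have av : a != v by apply: contraNneq aK' => ->.
  have vb := K4_outside_adj KK' aK' vK' bK' (cliqueP cK aK vK av) (cliqueP cT aT bT ab).
  by have := two _ vK vK'; rewrite vb ltnNge r1.
have /eqP <- : T :&: W == W by rewrite eqEcard subsetIr; lia.
exact: subsetIl.
Qed.

(** * The two upper bounds on the number of triangles *)

Lemma sum_s_split : \sum_v s v = \sum_(v in ~: W) s v + \sum_(v in W) s v.
Proof.
by rewrite (bigID (mem W)) addnC /=; congr (_ + _); apply: eq_bigl => v; rewrite in_setC.
Qed.

(* Summing [(8 D v - c)^2 >= 0] over [v]. *)
Lemma weighted_degree_bound c :
  16 * c * (\sum_v s v + 12 * k) <= 32 * n * \sum_v s v + 192 * k * (n + 8) + c * c * n.
Proof.
pose Q := \sum_v D v * D v.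
have defQ : 2 * Q = 2 * (\sum_v s v * D v) + 6 * (\sum_v r v * D v).
  by rewrite !big_distrr -big_split; apply: eq_bigr => v _ /=; nia.
have sD : \sum_v s v + 12 * k = \sum_v D v.
  by rewrite [RHS]big_split -big_distrr /= sum_r mulnA.
have : \sum_v 16 * c * D v <= \sum_v (64 * (D v * D v) + c * c).
  by apply: leq_sum => v _; have [+ _] := nat_Cauchy (8 * D v) c; rewrite -!mulnn; lia.
rewrite [X in _ <= X]big_split -!big_distrr /= sum_nat_const (eq_card (B := V)) // -sD -/Q.
have := sum_s_D; have := sum_r_D; move: defQ.
move: Q (\sum_v s v * D v) (\sum_v r v * D v) => Q SD RD.
by move: (\sum_v s v) k n => {sD} S' k' n'; lia.
Qed.

Lemma card_triangles_small : 4 <= n < 16 ->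
  #|[set T : {set V} | (#|T| == 3) && clique T]| <= max_triangles n.
Proof.
move=> n16; apply: leq_trans card_triangles_le _.
have := books_le_s; rewrite sum_s_split => b4.
have [sC sW] := (sum_s_covered, sum_s_uncovered).
apply: (small_bound (P := P) n16 (max_card (mem W)) card_uncovered).
- by apply: leq_trans sC; rewrite -addnA leq_addl.
- move: b4 sC sW.
  move: (\sum_(v in ~: W) _) (\sum_(v in W) _) (\sum_v r v * (r v).-1) => SC SW P'.
  by move: #|W| #|books| k n => N b k' n'; lia.
- case/card_gt0P=> T TB kW; have [kW3 P0 _] := book_few TB kW.
  split=> // /card_gt0P[x xW].
  (* All book triangles contain [W], hence [x], so [s x] alone bounds their number. *)
  apply: leq_trans sW; rewrite (big_setD1 x) //=; apply: leq_trans (leq_addr _ _).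
  by apply: books_le_s1 => T' T'B; have [_ _ /subsetP->] := book_few T'B kW.
Qed.

Lemma card_triangles_large : 16 <= n ->
  #|[set T : {set V} | (#|T| == 3) && clique T]| <= n ^ 2 %/ 8.
Proof.
move=> n16; apply: leq_trans card_triangles_le _.
exact: large_bound n16 books_le_s weighted_degree_bound.
Qed.

End Structure.

(** * Passage between encoded graphs and relations *)

Lemma p4hat_of_link n (E : {set 'I_n * 'I_n}) : simple_graph E ->
  ~~ contains_p4hat E -> link_P4_free (fun x y => (x, y) \in E).
Proof.
move=> /andP[_ /forallP E_sym] nE v a b c d un va vb vc vd ab bc cd.
have sym x y : (x, y) \in E -> (y, x) \in E by have /forallP/(_ y)/eqP-> := E_sym x.
case/existsP: nE; exists [ffun i : 'I_5 => nth v [:: a; b; c; d; v] i].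
apply/andP; split.
  apply/injectiveP => i j; rewrite !ffunE => /eqP.
  rewrite nth_uniq //; first by move/eqP/val_inj.
  by rewrite -(rot_uniq 4).
apply/forallP=> -[i i5]; apply/forallP=> -[j j5]; apply/implyP; rewrite !ffunE /p4hat_edge /=.
by case: i i5 => [|[|[|[|[|i]]]]] // _; case: j j5 => [|[|[|[|[|j]]]]] //= _ _; auto.
Qed.

Lemma ex_K3_P4hat_le n M :
  (forall g : rel 'I_n, symmetric g -> irreflexive g -> link_P4_free g ->
     #|[set T : {set 'I_n} | (#|T| == 3) && clique g T]| <= M) ->
  ex_K3_P4hat n <= M.
Proof.
move=> le; apply/bigmax_leqP => E /andP[Es En].
have [/forallP irr /forallP E_sym] := andP Es.
apply: (le (fun x y => (x, y) \in E)); last exact: p4hat_of_link.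
  by move=> x y; have /forallP/(_ y)/eqP := E_sym x.
  by move=> x; apply: negPf (irr x).
Qed.

(** Reduces lower bounds to arithmetic: [g] is restricted to ['I_n], and [L] lists triangles as
    increasing triples, so that distinct triples have distinct vertex sets. *)
Lemma ex_K3_P4hat_ge n (g : rel nat) (L : seq (nat * nat * nat)) :
  symmetric g -> irreflexive g ->
  (forall v a b c d, all (gtn n) [:: v; a; b; c; d] -> uniq [:: v; a; b; c; d] ->
     g v a -> g v b -> g v c -> g v d -> g a b -> g b c -> g c d -> False) ->
  uniq L ->
  (forall x y z, (x, y, z) \in L -> [/\ x < y, y < z & z < n] /\ [/\ g x y, g x z & g y z]) ->
  size L <= ex_K3_P4hat n.
Proof.
move=> g_sym g_irr g_free uL LP.
pose E := [set p : 'I_n * 'I_n | g p.1 p.2].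
have EP x y : ((x, y) \in E) = g x y by rewrite inE.
pose F (p : nat * nat * nat) := [set i : 'I_n | val i \in [:: p.1.1; p.1.2; p.2]].
have E_free : ~~ contains_p4hat E.
  apply/existsP => -[f /andP[/injectiveP f_inj /forallP fE]].
  pose o i := @inord 4 i.
  have e i j : i < 5 -> j < 5 -> p4hat_edge (o i) (o j) -> g (f (o i)) (f (o j)).
    by move=> i5 j5 ij; have /forallP/(_ (o j)) := fE (o i); rewrite ij EP.
  apply: (g_free (f (o 4)) (f (o 0)) (f (o 1)) (f (o 2)) (f (o 3)));
    try by apply: e => //; rewrite /p4hat_edge /o /= !inordK.
  - by rewrite /= !ltn_ord.
  - have -> : [:: val (f (o 4)); val (f (o 0)); val (f (o 1)); val (f (o 2)); val (f (o 3))] =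
      map (fun i => val (f (o i))) [:: 4; 0; 1; 2; 3] by [].
    rewrite map_inj_in_uniq // => i j; rewrite !inE => i5 j5 /val_inj/f_inj/(congr1 (@nat_of_ord 5)).
    by rewrite /o !inordK //; lia.
apply: (@leq_trans (triangles E)); last first.
  apply: (@leq_bigmax_cond _ _ (fun E : {set 'I_n * 'I_n} => triangles E)).
  rewrite E_free andbT; apply/andP; split; apply/forallP => x; first by rewrite EP g_irr.
  by apply/forallP => y; rewrite !EP g_sym.
apply/card_geqP; exists (map F L); split; last 1 first.
- move=> _ /mapP[[[x y] z] /LP[[xy yz zn] [gxy gxz gyz]] ->].
  have [xn yn] : x < n /\ y < n by lia.
  have -> : F (x, y, z) = [set Ordinal xn; Ordinal yn; Ordinal zn].
    by apply/setP => i; rewrite !inE -!val_eqE /= orbA.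
  rewrite inE; apply/andP; split.
    by rewrite setUC cardsU1 cards2 !inE -!val_eqE /=; lia.
  apply/forall_inP => i; rewrite !inE -orbA => iP.
  apply/forall_inP => j; rewrite !inE -orbA => jP; apply/implyP.
  case/or3P: iP => /eqP->; case/or3P: jP => /eqP->; rewrite ?eqxx ?inE //= => _.
  + by rewrite g_sym.
  + by rewrite g_sym.
  + by rewrite g_sym.
- rewrite map_inj_in_uniq // => -[[x y] z] [[x' y'] z'].
  move=> /LP[[xy yz zn] _] /LP[[xy' yz' zn'] _] /setP FF.
  have : [:: x; y; z] = [:: x'; y'; z'].
    apply: (irr_sorted_eq ltn_trans ltnn); rewrite /= ?xy ?xy' ?yz ?yz' // => i.
    have [i_n|i_n] := ltnP i n; first by have := FF (Ordinal i_n); rewrite !inE.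
    by rewrite !inE; lia.
  by case=> -> -> ->.
- by rewrite size_map.
Qed.

(** * Extremal constructions *)

(** Complete bipartite; the part below [2 * m] carries the matching of [2 * i] with [2 * i + 1], the
    other part is independent. *)
Definition book_graph m (x y : nat) : bool :=
  (x != y) && [|| (x < 2 * m <= y), (y < 2 * m <= x) |
    [&& x < 2 * m, y < 2 * m & x %/ 2 == y %/ 2]].

(** If [v] is in the independent part, [a] and [c] are both matched to [b]. Otherwise each of the
    edges [ab], [cd] has an end in the matched part, and both ends are matched to [v]. *)
Lemma book_graph_free m v a b c d : uniq [:: v; a; b; c; d] ->
  book_graph m v a -> book_graph m v b -> book_graph m v c -> book_graph m v d ->
  book_graph m a b -> book_graph m b c -> book_graph m c d -> False.
Proof.
rewrite /= !inE !negb_or => /and5P[/and4P[va vb vc vd] /and3P[ab ac ad] /andP[bc bd] cd _].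
have mate x y : x < 2 * m -> y < 2 * m -> book_graph m x y -> x %/ 2 = y %/ 2.
  by rewrite /book_graph; lia.
have far x y : 2 * m <= x -> book_graph m x y -> y < 2 * m by rewrite /book_graph; lia.
move=> gva gvb gvc gvd gab gbc gcd; have [v_m|v_m] := ltnP v (2 * m); last first.
  have [am bm cm] := And3 (far _ _ v_m gva) (far _ _ v_m gvb) (far _ _ v_m gvc).
  have := mate _ _ am bm gab; have := mate _ _ bm cm gbc; lia.
have [p [pab gvp pm]] : exists p, [/\ p \in [:: a; b], book_graph m v p & p < 2 * m].
  have [am|/far/(_ gab) bm] := ltnP a (2 * m); first by exists a; rewrite !inE eqxx.
  by exists b; rewrite !inE eqxx orbT.
have [q [qcd gvq qm]] : exists q, [/\ q \in [:: c; d], book_graph m v q & q < 2 * m].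
  have [cm|/far/(_ gcd) dm] := ltnP c (2 * m); first by exists c; rewrite !inE eqxx.
  by exists d; rewrite !inE eqxx orbT.
have := mate _ _ v_m pm gvp; have := mate _ _ v_m qm gvq.
have vp : v != p by move: pab; rewrite !inE => /orP[] /eqP->.
have vq : v != q by move: qcd; rewrite !inE => /orP[] /eqP->.
have pq : p != q by move: pab qcd; rewrite !inE => /orP[] /eqP-> /orP[] /eqP->.
by clear - vp vq pq; lia.
Qed.

Lemma ex_K3_P4hat_ge_book n m : 2 * m <= n -> m * (n - 2 * m) <= ex_K3_P4hat n.
Proof.
move=> mn; pose L := [seq (2 * i, (2 * i).+1, j) | i <- iota 0 m, j <- iota (2 * m) (n - 2 * m)].
have <- : size L = m * (n - 2 * m) by rewrite size_allpairs !size_iota.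
apply: (@ex_K3_P4hat_ge n (book_graph m)).
- by move=> x y; rewrite /book_graph; lia.
- by move=> x; rewrite /book_graph eqxx.
- by move=> v a b c d _; apply: book_graph_free.
- apply: allpairs_uniq; rewrite ?iota_uniq // => -[i j] [i' j'] _ _ [] /= e _ ->.
  by congr (_, _); lia.
- move=> x y z /allpairsP[[i j] /= [+ + [-> -> ->]]]; rewrite !mem_iota /book_graph => i_m jn.
  by split; split; lia.
Qed.

Definition two_K4 (x y : nat) : bool :=
  (x != y) && ((x <= 3) && (y <= 3) || (3 <= x) && (3 <= y)).

Lemma two_K4_free :
  all (fun v => all (fun a => all (fun b => all (fun c => all (fun d =>
    ~~ (uniq [:: v; a; b; c; d] &&
        all2 two_K4 [:: v; v; v; v; a; b; c] [:: a; b; c; d; b; c; d]))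
  (iota 0 7)) (iota 0 7)) (iota 0 7)) (iota 0 7)) (iota 0 7).
Proof. by vm_compute. Qed.

(** The filtered list has 4, 4, 5, 8 entries for [n] equal to 4, 5, 6, 7. *)
Lemma ex_K3_P4hat_ge_two_K4 n : n <= 7 ->
  size [seq t <- [:: (0,1,2); (0,1,3); (0,2,3); (1,2,3); (3,4,5); (3,4,6); (3,5,6); (4,5,6)] | t.2 < n]
    <= ex_K3_P4hat n.
Proof.
move=> n7; apply: (@ex_K3_P4hat_ge n two_K4).
- by move=> x y; rewrite /two_K4; lia.
- by move=> x; rewrite /two_K4 eqxx.
- move=> v a b c d /= /and5P[vn an bn cn /andP[dn _]] un va vb vc vd ab bc cd.
  have in7 x : gtn n x -> x \in iota 0 7 by move=> xn; rewrite mem_iota (leq_trans xn).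
  have := allP two_K4_free _ (in7 _ vn); move/allP/(_ _ (in7 _ an)).
  move/allP/(_ _ (in7 _ bn))/allP/(_ _ (in7 _ cn))/allP/(_ _ (in7 _ dn)).
  by rewrite /= un va vb vc vd ab bc cd.
- exact: filter_uniq.
- move=> x y z; rewrite mem_filter !inE /two_K4.
  move=> /andP[/= zn]; do 7?[case/orP]; case/eqP=> ? ? ?; subst; by split; split; lia.
Qed.

Theorem theorem1 :
  (forall n : nat, 8 <= n -> ex_K3_P4hat n = n ^ 2 %/ 8) /\
  ex_K3_P4hat 4 = 4 /\ ex_K3_P4hat 5 = 4 /\
  ex_K3_P4hat 6 = 5 /\ ex_K3_P4hat 7 = 8.
Proof.
have le n : 4 <= n -> ex_K3_P4hat n <= max_triangles n.
  move=> n4; apply: ex_K3_P4hat_le => g g_sym g_irr g_free; rewrite -[n in leqRHS]card_ord.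
  have [n16|n16] := ltnP n 16.
    by apply: card_triangles_small => //; rewrite card_ord n4.
  rewrite /max_triangles !ifF ?card_ord; try lia.
  by have := card_triangles_large g_sym g_irr g_free; rewrite card_ord; apply.
split=> [n n8|]; last first.
  have ge := ex_K3_P4hat_ge_two_K4.
  do 3?split; apply/eqP; rewrite eqn_leq; apply/andP; split;
    first [exact: (le 4) | exact: (le 5) | exact: (le 6) | exact: (le 7)
          | exact: (ge 4) | exact: (ge 5) | exact: (ge 6) | exact: (ge 7)].
apply/eqP; rewrite eqn_leq; apply/andP; split.
  have : max_triangles n = n ^ 2 %/ 8 by rewrite /max_triangles !ifF //; lia.
  by move=> <-; apply: le; lia.
(* This makes [2 * m] an even number nearest to [n / 2]. *)
pose m := (n + 1) %/ 4; have mn : 2 * m <= n by rewrite /m; lia.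
apply: leq_trans (ex_K3_P4hat_ge_book mn).
rewrite -ltnS ltn_divLR // -mulnn -addn1.
have [l nl] : exists l, n = 2 * m + l by exists (n - 2 * m); lia.
have near : 2 * m <= l + 1 /\ l <= 2 * m + 2 by rewrite /m in nl *; lia.
rewrite {}nl addKn; move: m near {mn} => m near.
(* Here [(2 * m + l) ^ 2 = 8 * m * l + (l - 2 * m) ^ 2], and the last square is at most 4. *)
have : l + 1 \in [:: 2 * m; 2 * m + 1; 2 * m + 2; 2 * m + 3] by rewrite !inE; lia.
by rewrite !inE; case/or4P => /eqP ?; nia.
Qed.
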